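(* Let $\mathcal{C}$ be a super-modular category with fermionic symmetry action $[\rho]$ of $G_b$ for the fermionic symmetry group determined by $\omega_2=(-1)^{\tilde\omega_2}\in Z^2(G_b,\mathbb{Z}_2)$, let $\check{\mathcal{C}}$ be a minimal modular extension, let $\check{\rho}_{\bf g}$, ${\bf g}\in G_b$, be lifts of $\rho_{\bf g}$ to $\check{\mathcal{C}}$ with associated obstruction cocycle $o_2\in Z^2(G_b,\ker r)$, and suppose $\ker r=\{[1],[\alpha_\psi]\}\simeq\mathbb{Z}_2$. Write $o_2({\bf g,h})=[\alpha_\psi]^{\tilde{o}_2({\bf g,h})}$ with $\tilde{o}_2({\bf g,h})\in\{0,1\}$. Then for every spin structure $(\mu,\nu)\in\{0,1\}^2$ on the torus and every state $|\Psi\rangle_{\mu\nu}\in\mathcal{H}_{\mu,\nu}$ of the torus Hilbert space, $$\check{\rho}_{\bf gh}\check{\rho}_{\bf h}^{-1}\check{\rho}_{\bf g}^{-1}|\Psi\rangle_{\mu\nu}=(\omega_2({\bf g,h}))^F(-1)^{\tilde{o}_2({\bf g,h})\,\mathrm{Arf}(\mu,\nu)}|\Psi\rangle_{\mu\nu},$$ where $\mathrm{Arf}(\mu,\nu)=\mu\nu$ and $(-1)^F$ is the fermion parity operator on the torus Hilbert space.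
   Context: A super-modular category $\mathcal{C}$ is a unitary braided fusion category with exactly one nontrivial simple object $\psi$ that braids trivially with all objects, where $\psi$ is a fermion: $\theta_\psi=-1$, $\psi\times\psi=1$. A minimal modular extension $\check{\mathcal{C}}$ is a UMTC containing $\mathcal{C}$ as a full braided fusion subcategory, with $\mathcal{D}_{\check{\mathcal{C}}}^2=2\mathcal{D}_{\mathcal{C}}^2$. It is graded, $\check{\mathcal{C}}=\check{\mathcal{C}}_0\oplus\check{\mathcal{C}}_1$, by the double braid $M_{a,\psi}=\pm1$, with $\check{\mathcal{C}}_0=\mathcal{C}$; and $\check{\mathcal{C}}_1=\check{\mathcal{C}}_v\oplus\check{\mathcal{C}}_\sigma$, where $a\in\check{\mathcal{C}}_v$ if $a\times\psi\neq a$ and $a\in\check{\mathcal{C}}_\sigma$ if $a\times\psi=a$. Autoequivalences. For $\mathcal{B}=\mathcal{C}$ or $\check{\mathcal{C}}$, a topological autoequivalence is a braided autoequivalence or (anti-unitary) braided anti-autoequivalence fixing $\psi$; it acts on fusion vertices by $\rho|a,b;c;\mu\rangle=\sum_\nu U_\rho(\rho(a),\rho(b);\rho(c))_{\mu\nu}|\rho(a),\rho(b);\rho(c);\nu\rangle$, extended antilinearly if anti-unitary. Natural isomorphisms act as $|a,b;c;\mu\rangle\mapsto\frac{\gamma_a\gamma_b}{\gamma_c}|a,b;c;\mu\rangle$, $\gamma_a\in\mathrm{U}(1)$; one ''respects locality'' if it can be written with $\gamma_\psi=+1$. $\mathrm{Aut}_{LR}(\mathcal{B})$ is the group of topological autoequivalences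 acting trivially on $|\psi,\psi;1\rangle$, modulo locality-respecting natural isomorphisms. $\Upsilon_\psi$ on $\mathcal{C}$ and $\check{\Upsilon}_\psi$ on $\check{\mathcal{C}}$ are the natural isomorphisms with $\gamma_\psi=-1$ and $\gamma_a=1$ for all other $a$. $r:\mathrm{Aut}_{LR}(\check{\mathcal{C}})\to\mathrm{Aut}_{LR}(\mathcal{C})$ is restriction. If $\check{\Upsilon}_\psi$ respects locality, then $\check{\mathcal{C}}_\sigma$ is empty. $\alpha_\psi$ is the autoequivalence of $\check{\mathcal{C}}$ with permutation action $\alpha_\psi(a)=a$ for $a\in\check{\mathcal{C}}_0$, $\alpha_\psi(a)=a\times\psi$ for $a\in\check{\mathcal{C}}_1$, and, writing $a'=\alpha_\psi(a)$ and $f_x=0$ for $x\in\check{\mathcal{C}}_0$, $f_x=1$ for $x\in\check{\mathcal{C}}_1$, $$U_{\alpha_\psi}(a',b';c')_{\mu\nu}=\sum_\lambda\left[\left(F^{a,\psi^{f_b},b'}_{c}\right)^{-1}\right]_{(b,\mu),(a\times\psi^{f_b},\lambda)}R^{\psi^{f_b},a}\left[\left(F^{\psi^{f_c},\psi^{f_b}\times a,b'}_{c'}\right)^{-1}\right]_{(c,\lambda),(a',\nu)}.$$ It is known that $[\alpha_\psi]\in\ker r$, $[\alpha_\psi]^2=[1]$, and $U_{\alpha_\psi}(\sigma,\psi;\sigma)=-1$ for $\sigma\in\check{\mathcal{C}}_\sigma$. Symmetry. Each ${\bf g}\in G_b$ is unitary or anti-unitary, with $\rho_{\bf g}$ accordingly.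 $[\rho]:G_b\to\mathrm{Aut}_{LR}(\mathcal{C})$ is a homomorphism if $\Upsilon_\psi$ respects locality and satisfies $[\Upsilon_\psi]^{\tilde\omega_2({\bf g,h})}[\rho_{\bf g}][\rho_{\bf h}]=[\rho_{\bf gh}]$ otherwise. A lift is $[\check{\rho}_{\bf g}]$ with $r([\check{\rho}_{\bf g}])=[\rho_{\bf g}]$, and $o_2({\bf g,h})=[\check{\rho}_{\bf gh}\check{\rho}_{\bf h}^{-1}\check{\rho}_{\bf g}^{-1}]$ if $\check{\Upsilon}_\psi$ respects locality, $o_2({\bf g,h})=[\check{\rho}_{\bf gh}\check{\rho}_{\bf h}^{-1}\check{\rho}_{\bf g}^{-1}\check{\Upsilon}_\psi^{\tilde\omega_2({\bf g,h})}]$ otherwise. Torus Hilbert space. For $\mu,\nu\in\{0,1\}$ ($0$ = anti-periodic, $1$ = periodic boundary conditions on the two cycles), let $|a\rangle$ span $V_1^{a\bar a}\otimes V^1_{a\bar a}$ (torus state with charge $a$) and let $|\sigma;\psi\rangle$ span $V_1^{\sigma\bar\sigma}\otimes V^{\psi}_{\sigma\bar\sigma}$ (torus with a $\psi$ puncture), where $V^{ab}_c$ is the splitting space and $V_{ab}^c$ its dual. Then $\mathcal{H}_{0,0}$ has basis $\frac{1}{\sqrt2}(|a\rangle+|a\times\psi\rangle)$ and $\mathcal{H}_{0,1}$ has basis $\frac1{\sqrt2}(|a\rangle-|a\times\psi\rangle)$, $a\in\check{\mathcal{C}}_0$ (one per $\psi$-orbit); $\mathcal{H}_{1,0}$ has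 basis $\frac1{\sqrt2}(|v\rangle+|v\times\psi\rangle)$, $v\in\check{\mathcal{C}}_v$, and $|\sigma\rangle$, $\sigma\in\check{\mathcal{C}}_\sigma$; $\mathcal{H}_{1,1}$ has basis $\frac1{\sqrt2}(|v\rangle-|v\times\psi\rangle)$, $v\in\check{\mathcal{C}}_v$, and $|\sigma;\psi\rangle$, $\sigma\in\check{\mathcal{C}}_\sigma$. Fermion parity $(-1)^F$ is $-1$ on the states $|\sigma;\psi\rangle$ and $+1$ on all other basis states; $(\omega_2)^F$ means $(-1)^{F\tilde\omega_2}$. An autoequivalence of $\check{\mathcal{C}}$ acts on these states through its action on the splitting spaces $V_c^{ab}$ and the induced (dual) action on $V^c_{ab}$. *)

(* Defs.v *)
From mathcomp Require Import all_boot all_order all_algebra.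
From mathcomp Require Import boolp.

Set Implicit Arguments.
Unset Strict Implicit.
Unset Printing Implicit Defensive.

Import GRing.Theory Num.Theory.
Local Open Scope ring_scope.

(* Unitary braided fusion categories are given skeletally, by their F- and
   R-symbols in an orthonormal basis |a,b;c,mu>, mu < N a b c, of each V^{ab}_c:

     |a,b;e,al>|e,c;d,be>
        = \sum_(f,mu,nu) F a b c d e f al be mu nu |b,c;f,mu>|a,f;d,nu>
     R^{ab} |b,a;c,mu> = \sum_nu R a b c mu nu |a,b;c,nu>

   i.e. F a b c d e f al be mu nu is [F^{abc}_d]_{(e,al,be),(f,mu,nu)} and
   R a b c mu nu is [R^{ab}_c]_{mu,nu}.  Vertex labels are natural numbers; only
   the values below the relevant multiplicity N are meaningful, and all
   quantifiers and sums over them are bounded accordingly. *)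
Record anyonData (K : numClosedFieldType) := AnyonData {
  label :> finType;
  vac : label;
  dual : label -> label;
  Nf : label -> label -> label -> nat;
  Fsym : label -> label -> label -> label -> label -> label ->
         nat -> nat -> nat -> nat -> K;
  Rsym : label -> label -> label -> nat -> nat -> K
}.

Arguments vac {K} a.
Arguments dual {K a} _.
Arguments Nf {K a} _ _ _.
Arguments Fsym {K a} _ _ _ _ _ _ _ _ _ _.
Arguments Rsym {K a} _ _ _ _ _.

Section Categories.
Variables (K : numClosedFieldType) (B : anyonData K).
Implicit Types a b c d e f g h k l x y : B.

(* [(F^{abc}_d)^{-1}]_{(f,mu,nu),(e,al,be)}, F being unitary; the arguments are
   kept in the order of those of Fsym. *)
Definition Finv a b c d e f (al be mu nu : nat) : K :=
  (Fsym a b c d e f al be mu nu)^*.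

(* [(R^{ab}_c)^{-1}]_{nu,mu}, R being unitary. *)
Definition Rinv a b c (nu mu : nat) : K := (Rsym a b c mu nu)^*.

Record fusion_rules : Prop := FusionRules {
  fusionA : forall a b c d,
    (\sum_e Nf a b e * Nf e c d = \sum_f Nf b c f * Nf a f d)%N;
  fusionC : forall a b c, Nf a b c = Nf b a c;
  fusion1r : forall a c, Nf a (vac B) c = (a == c);
  fusion1l : forall a c, Nf (vac B) a c = (a == c);
  fusionV : forall a b, Nf a b (vac B) = (b == dual a)
}.

Definition F_unitary : Prop :=
  (forall a b c d e e' (al : 'I_(Nf a b e)) (be : 'I_(Nf e c d))
     (al' : 'I_(Nf a b e')) (be' : 'I_(Nf e' c d)),
     \sum_f \sum_(mu < Nf b c f) \sum_(nu < Nf a f d)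
       Fsym a b c d e f al be mu nu * (Fsym a b c d e' f al' be' mu nu)^*
     = [&& e == e', al == al' :> nat & be == be' :> nat]%:R)
  /\
  (forall a b c d f f' (mu : 'I_(Nf b c f)) (nu : 'I_(Nf a f d))
     (mu' : 'I_(Nf b c f')) (nu' : 'I_(Nf a f' d)),
     \sum_e \sum_(al < Nf a b e) \sum_(be < Nf e c d)
       (Fsym a b c d e f al be mu nu)^* * Fsym a b c d e f' al be mu' nu'
     = [&& f == f', mu == mu' :> nat & nu == nu' :> nat]%:R).

(* The vertices with a vacuum leg are the canonical ones: F^{abc}_d is trivial
   whenever one of a, b, c is the vacuum. *)
Definition F_unital : Prop :=
  [/\ forall b c d (be mu : 'I_(Nf b c d)),
        Fsym (vac B) b c d b d 0 be mu 0 = (be == mu)%:R,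
      forall a c d (be nu : 'I_(Nf a c d)),
        Fsym a (vac B) c d a c 0 be 0 nu = (be == nu)%:R
    & forall a b d (al nu : 'I_(Nf a b d)),
        Fsym a b (vac B) d d b al 0 0 nu = (al == nu)%:R].

Definition pentagon : Prop :=
  forall a b c d e f g k l
    (al : 'I_(Nf a b f)) (be : 'I_(Nf f c g)) (ga : 'I_(Nf g d e))
    (de : 'I_(Nf c d l)) (la : 'I_(Nf b l k)) (mu : 'I_(Nf a k e)),
    \sum_(nu < Nf f l e)
      Fsym f c d e g l be ga de nu * Fsym a b l e f k al nu la mu
    = \sum_h \sum_(si < Nf b c h) \sum_(ps < Nf a h g) \sum_(ro < Nf h d k)
        Fsym a b c g f h al be si ps * Fsym a h d e g k ps ga ro mu
        * Fsym b c d k h l si ro de la.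

Definition R_unitary : Prop :=
  forall a b c (mu mu' : 'I_(Nf b a c)),
    \sum_(nu < Nf a b c) Rsym a b c mu nu * (Rsym a b c mu' nu)^*
    = (mu == mu')%:R.

Definition hexagon : Prop :=
  forall a b c d e g
    (al : 'I_(Nf c a e)) (be : 'I_(Nf e b d)) (mu : 'I_(Nf b c g))
    (nu : 'I_(Nf a g d)),
    \sum_(la < Nf a c e) \sum_(ga < Nf c b g)
      Rsym a c e al la * Fsym a c b d e g la be ga nu * Rsym b c g ga mu
    = \sum_f \sum_(de < Nf a b f) \sum_(si < Nf c f d) \sum_(ps < Nf f c d)
        Fsym c a b d e f al be de si * Rsym f c d si ps
        * Fsym a b c d f g de ps mu nu.

Definition hexagon_inv : Prop :=
  forall a b c d e g
    (al : 'I_(Nf c a e)) (be : 'I_(Nf e b d)) (mu : 'I_(Nf b c g))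
    (nu : 'I_(Nf a g d)),
    \sum_(la < Nf a c e) \sum_(ga < Nf c b g)
      Rinv c a e al la * Fsym a c b d e g la be ga nu * Rinv c b g ga mu
    = \sum_f \sum_(de < Nf a b f) \sum_(si < Nf c f d) \sum_(ps < Nf f c d)
        Fsym c a b d e f al be de si * Rinv c f d si ps
        * Fsym a b c d f g de ps mu nu.

(* Unitary braided fusion category; ubfc_rigid says that the cup and cap of
   the pair (a, dual a) compose to a nonzero multiple of the identity. *)
Record is_UBFC : Prop := IsUBFC {
  ubfc_fusion : fusion_rules;
  ubfc_F_unitary : F_unitary;
  ubfc_F_unital : F_unital;
  ubfc_pentagon : pentagon;
  ubfc_rigid : forall a, Fsym a (dual a) a a (vac B) (vac B) 0 0 0 0 != 0;
  ubfc_R_unitary : R_unitary;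
  ubfc_hexagon : hexagon;
  ubfc_hexagon_inv : hexagon_inv
}.

Definition qdim a : K := `|Fsym a (dual a) a a (vac B) (vac B) 0 0 0 0|^-1.

(* The square of the total quantum dimension, D^2. *)
Definition total_dim2 : K := \sum_a qdim a ^+ 2.

Definition twist a : K :=
  \sum_c \sum_(mu < Nf a a c) qdim c / qdim a * Rsym a a c mu mu.

Definition Sentry a b : K :=
  (sqrtC total_dim2)^-1
  * \sum_c (Nf (dual a) b c)%:R * (twist c / (twist a * twist b)) * qdim c.

Definition Smatrix : 'M[K]_#|B| :=
  \matrix_(i, j) Sentry (enum_val i) (enum_val j).

Definition is_UMTC : Prop := is_UBFC /\ Smatrix \in unitmx.

(* Matrix entries on V^{ab}_c of the double braid R^{ba} R^{ab}. *)
Definition double_braid a b c (mu nu : nat) : K :=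
  \sum_(la < Nf b a c) Rsym b a c mu la * Rsym a b c la nu.

Definition braids_trivially a b : bool :=
  [forall c, forall mu : 'I_(Nf a b c), forall nu : 'I_(Nf a b c),
     double_braid a b c mu nu == (mu == nu)%:R].

Definition is_supermodular (psi : B) : Prop :=
  [/\ is_UBFC,
      psi != vac B,
      forall x, (forall a, braids_trivially a x) <-> x = vac B \/ x = psi,
      forall c, Nf psi psi c = (c == vac B)
    & twist psi = -1].

End Categories.

Arguments total_dim2 {K} B.

(* The full braided fusion subcategory is given by an injection iota on simple
   objects whose image is closed under fusion, the F- and R-symbols of C being
   the restrictions of those of Cx. *)
Definition minimal_modular_extension (K : numClosedFieldType)
    (C Cx : anyonData K) (iota : C -> Cx) : Prop :=
  [/\ is_UMTC Cx,
      [/\ injective iota,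
          iota (vac C) = vac Cx,
          forall a b c, Nf (iota a) (iota b) (iota c) = Nf a b c
        & forall a b x, Nf (iota a) (iota b) x != 0%N -> exists c, x = iota c],
      forall a b c d e f (al : 'I_(Nf a b e)) (be : 'I_(Nf e c d))
        (mu : 'I_(Nf b c f)) (nu : 'I_(Nf a f d)),
        Fsym (iota a) (iota b) (iota c) (iota d) (iota e) (iota f) al be mu nu
        = Fsym a b c d e f al be mu nu,
      forall a b c (mu : 'I_(Nf b a c)) (nu : 'I_(Nf a b c)),
        Rsym (iota a) (iota b) (iota c) mu nu = Rsym a b c mu nu
    & total_dim2 Cx = 2 * total_dim2 C].

(* Data of an autoequivalence: its action on simple objects, its action on
   vertices, indexed by the SOURCE objects, i.e. avtx rho a b c mu nu is
   U_rho(rho a, rho b; rho c)_{mu,nu} in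
     rho |a,b;c,mu> = \sum_nu U_rho(rho a, rho b; rho c)_{mu,nu}
                               |rho a, rho b; rho c, nu>,
   and whether it is anti-unitary. *)
Record autoData (K : numClosedFieldType) (B : anyonData K) := AutoData {
  aobj :> B -> B;
  avtx : B -> B -> B -> nat -> nat -> K;
  aanti : bool
}.

Definition conj_if (K : numClosedFieldType) (q : bool) (z : K) : K :=
  if q then z^* else z.

Section Autoequivalences.
Variables (K : numClosedFieldType) (B : anyonData K) (psi : B).
Implicit Types (a b c d e f : B) (rho sigma : autoData B) (gamma : B -> K).

(* rho is applied to both sides of the equations defining F and R, complex
   conjugating the symbols when it is antilinear. *)
Record is_topological_aut rho : Prop := IsTopologicalAut {
  aut_inj : injective rho;
  aut_vac : rho (vac B) = vac B;
  aut_psi : rho psi = psi;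
  aut_N : forall a b c, Nf (rho a) (rho b) (rho c) = Nf a b c;
  aut_unitary : forall a b c (mu mu' : 'I_(Nf a b c)),
    \sum_(nu < Nf a b c) avtx rho a b c mu nu * (avtx rho a b c mu' nu)^*
    = (mu == mu')%:R;
  aut_unital : forall a,
    avtx rho a (vac B) a 0 0 = 1 /\ avtx rho (vac B) a a 0 0 = 1;
  aut_F : forall a b c d e f (al : 'I_(Nf a b e)) (be : 'I_(Nf e c d))
      (mu : 'I_(Nf b c f)) (nu : 'I_(Nf a f d)),
    \sum_(al' < Nf a b e) \sum_(be' < Nf e c d)
      avtx rho a b e al al' * avtx rho e c d be be'
      * Fsym (rho a) (rho b) (rho c) (rho d) (rho e) (rho f) al' be' mu nu
    = \sum_(mu' < Nf b c f) \sum_(nu' < Nf a f d)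
        conj_if (aanti rho) (Fsym a b c d e f al be mu' nu')
        * avtx rho b c f mu' mu * avtx rho a f d nu' nu;
  aut_R : forall a b c (mu : 'I_(Nf b a c)) (nu : 'I_(Nf a b c)),
    \sum_(mu' < Nf b a c)
      avtx rho b a c mu mu' * Rsym (rho a) (rho b) (rho c) mu' nu
    = \sum_(nu' < Nf a b c)
        conj_if (aanti rho) (Rsym a b c mu nu') * avtx rho a b c nu' nu
}.

Definition aut_id : autoData B :=
  AutoData (fun a => a) (fun _ _ _ mu nu => (mu == nu)%:R) false.

Definition aut_comp rho sigma : autoData B :=
  AutoData (fun a => rho (sigma a))
    (fun a b c mu nu =>
       \sum_(la < Nf a b c)
         conj_if (aanti rho) (avtx sigma a b c mu la)
         * avtx rho (sigma a) (sigma b) (sigma c) la nu)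
    (aanti rho (+) aanti sigma).

(* The inverse of a unitary matrix is its conjugate transpose. *)
Definition aut_inv rho : autoData B :=
  let r := finv rho in
  AutoData r
    (fun a b c mu nu =>
       conj_if (aanti rho) (avtx rho (r a) (r b) (r c) nu mu)^*)
    (aanti rho).

Definition aut_expb rho (n : bool) : autoData B := if n then rho else aut_id.

Definition same_aut rho sigma : Prop :=
  [/\ aanti rho = aanti sigma,
      forall a, rho a = sigma a
    & forall a b c (mu nu : 'I_(Nf a b c)),
        avtx rho a b c mu nu = avtx sigma a b c mu nu].

Definition nat_iso gamma : autoData B :=
  AutoData (fun a => a)
    (fun a b c mu nu => gamma a * gamma b / gamma c * (mu == nu)%:R) false.

(* gamma (vac B) = 1 keeps the vertices with a vacuum leg fixed. *)
Definition phases gamma : Prop :=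
  (forall a, `|gamma a| = 1) /\ gamma (vac B) = 1.

Definition respects_locality rho : Prop :=
  exists gamma, [/\ phases gamma, gamma psi = 1 & same_aut rho (nat_iso gamma)].

Definition Upsilon_psi : autoData B :=
  nat_iso (fun a => if a == psi then -1 else 1).

Definition is_LR_aut rho : Prop :=
  is_topological_aut rho /\ avtx rho psi psi (vac B) 0 0 = 1.

(* Equality [rho] = [sigma] of classes modulo locality-respecting natural
   isomorphisms. *)
Definition LR_eq rho sigma : Prop :=
  exists Ups, respects_locality Ups /\ same_aut (aut_comp Ups rho) sigma.

End Autoequivalences.

Arguments aut_id {K B}.

Section Restriction.
Variables (K : numClosedFieldType) (C Cx : anyonData K) (iota : C -> Cx).
Variable psi : C.
Implicit Types (X : autoData Cx) (rho : autoData C).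

Definition restricts_to X rho : Prop :=
  [/\ aanti X = aanti rho,
      forall a, X (iota a) = iota (rho a)
    & forall a b c (mu nu : 'I_(Nf a b c)),
        avtx X (iota a) (iota b) (iota c) mu nu = avtx rho a b c mu nu].

(* r([X]) = [rho] *)
Definition r_maps_to X rho : Prop :=
  exists rho', restricts_to X rho' /\ LR_eq psi rho' rho.

Definition in_ker_r X : Prop :=
  is_LR_aut (iota psi) X /\ r_maps_to X aut_id.

End Restriction.

Section Grading.
Variables (K : numClosedFieldType) (B : anyonData K) (psi : B).

(* The double braid with psi is +1 or -1 on every simple object. *)
Definition in_sector0 (a : B) : bool := braids_trivially a psi.
Definition in_sector1 (a : B) : bool := ~~ in_sector0 a.

(* The unique simple object a x psi. *)
Definition fuse_psi (a : B) : B := odflt a [pick c | Nf a psi c != 0%N].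

Definition in_v (a : B) : bool := in_sector1 a && (fuse_psi a != a).
Definition in_sigma (a : B) : bool := in_sector1 a && (fuse_psi a == a).

(* psi^n and a x psi^n for n = 0, 1 *)
Definition psi_exp (n : bool) : B := if n then psi else vac B.
Definition fuse_psi_exp (n : bool) (a : B) : B := if n then fuse_psi a else a.

(* U_alpha(a',b';c') as a function of the sources a, b, c, where a' = alpha a
   etc.; all the vertices with a leg psi^n are one-dimensional, whence their
   label 0.  The formula is written for vertex bases such that
   F^{psi,psi,a}_a = 1 for all a, which can always be achieved. *)
Definition alpha_psi : autoData B :=
  let f := in_sector1 in
  let al := fun a => fuse_psi_exp (f a) a in
  AutoData al
    (fun a b c mu nu =>
       let fb := f b in let fc := f c in
       let ab := fuse_psi_exp fb a in
       \sum_(la < Nf ab (al b) c)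
         Finv a (psi_exp fb) (al b) c ab b 0 la 0 mu
         * Rsym (psi_exp fb) a ab 0 0
         * Finv (psi_exp fc) ab (al b) (al c) (al a) c 0 nu la 0)
    false.

End Grading.

(* A Z_2-valued 2-cocycle, written additively. *)
Definition is_cocycle2 (G : groupType) (w : G -> G -> bool) : Prop :=
  forall g h k : G, w g h (+) w (g * h)%g k = w h k (+) w g (h * k)%g.

(* Fermionic symmetry action; q g tells whether g is anti-unitary, and rho g
   is a representative of the class [rho_g]. *)
Definition fermionic_action (K : numClosedFieldType) (C : anyonData K) (psi : C)
    (G : groupType) (q : G -> bool) (w : G -> G -> bool)
    (rho : G -> autoData C) : Prop :=
  [/\ forall g, is_LR_aut psi (rho g),
      forall g, aanti (rho g) = q g
    & forall g h,
        if `[< respects_locality psi (Upsilon_psi psi) >]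
        then LR_eq psi (aut_comp (rho g) (rho h)) (rho (g * h)%g)
        else LR_eq psi
               (aut_comp (aut_expb (Upsilon_psi psi) (w g h))
                         (aut_comp (rho g) (rho h)))
               (rho (g * h)%g)].

Section Obstruction.
Variables (K : numClosedFieldType) (B : anyonData K) (psi : B).
Variables (G : groupType) (X : G -> autoData B).

(* X_{gh} X_h^{-1} X_g^{-1} *)
Definition lift_defect (g h : G) : autoData B :=
  aut_comp (aut_comp (X (g * h)%g) (aut_inv (X h))) (aut_inv (X g)).

(* A representative of o_2(g,h). *)
Definition obstruction2 (w : G -> G -> bool) (g h : G) : autoData B :=
  if `[< respects_locality psi (Upsilon_psi psi) >] then lift_defect g h
  else aut_comp (lift_defect g h) (aut_expb (Upsilon_psi psi) (w g h)).

End Obstruction.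

(* Torus states: (a, false) indexes |a>, spanning V_1^{a,dual a} (x)
   V^1_{a,dual a}, and (a, true) indexes |a;psi>, spanning V_1^{a,dual a} (x)
   V^psi_{a,dual a}; the latter occurs in the spaces Hspace only for a in the
   sigma sector, where V^psi_{a,dual a} is one-dimensional. *)
Notation torus_space K B := {ffun label B * bool -> K^o}.

Section Torus.
Variables (K : numClosedFieldType) (B : anyonData K) (psi : B).

Definition ket (a : B) (p : bool) : torus_space K B :=
  [ffun x => (x == (a, p))%:R].

(* (|a> + (-1)^n |a x psi>) / sqrt 2 *)
Definition ket_orbit (n : bool) (a : B) : torus_space K B :=
  (sqrtC 2 : K)^-1 *: (ket a false + (-1) ^+ n *: ket (fuse_psi psi a) false).

(* Spanning families; an orbit {a, a x psi} contributes twice, by the same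
   vector up to sign. *)
Definition torus_basis (mu nu : bool) : seq (torus_space K B) :=
  if ~~ mu then [seq ket_orbit nu a | a in in_sector0 psi]
  else [seq ket_orbit nu v | v in in_v psi]
       ++ [seq ket s nu | s in in_sigma psi].

Definition Hspace (mu nu : bool) : {vspace torus_space K B} :=
  <<torus_basis mu nu>>%VS.

(* rho sends the vertex state of V_c^{ab} by U and its dual by U^*. *)
Definition torus_act (rho : autoData B) (Psi : torus_space K B) :
    torus_space K B :=
  \sum_a \sum_p
    (conj_if (aanti rho) (Psi (a, p))
     * (avtx rho a (dual a) (vac B) 0 0
        * (avtx rho a (dual a) (psi_exp psi p) 0 0)^*))
    *: ket (rho a) p.

(* ((-1)^F)^w *)
Definition parity_exp (w : bool) (Psi : torus_space K B) : torus_space K B :=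
  [ffun x => (-1) ^+ (w && x.2) * Psi x].

End Torus.

Definition Arf (mu nu : bool) : nat := (mu * nu)%N.

(* Main.v *)
(** The defect X_{gh} X_h^{-1} X_g^{-1}, composed with a power of Upsilon_psi, is
    alpha_psi^{o2} up to a natural isomorphism with gamma_psi = 1. On |a> an
    autoequivalence only permutes labels, since U(a,dual a;1) is multiplied by
    its own conjugate; this gives the sign of |v> - |v x psi>. On |s;psi> it
    contributes in addition the phase U(s,dual s;1) U(s,dual s;psi)^*, which is
    invariant under locality-respecting natural isomorphisms and changes sign
    under Upsilon_psi. For alpha_psi this phase equals U(s,psi;s), by naturality
    of F and R, hence (F^{psi,s,psi}_s)^* by the defining formula, and the
    hexagon gives F^{psi,s,psi}_s = R^{psi,psi}_1 = theta_psi = -1. *)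

Require Import Defs.
From mathcomp Require Import all_boot all_order all_algebra.
From mathcomp Require Import boolp.
From mathcomp Require Import reals complex.

Import GRing.Theory Num.Theory.
Local Open Scope ring_scope.

(** * Sums over one-dimensional vertex spaces; induction on a span *)

Lemma eq1_gt0 {n : nat} : n = 1%N -> (0 < n)%N.
Proof. by move->. Qed.

(** An explicit ordinal, whose value reduces to the literal label [0] used for one-dimensional
    vertices. *)
Notation ord_of1 n1 := (Ordinal (eq1_gt0 n1)).

Lemma big_ord_eq1 {V : nmodType} {n : nat} (n1 : n = 1%N) (F : 'I_n -> V) :
  \sum_(i < n) F i = F (ord_of1 n1).
Proof.
by case: _ / (esym n1) F (eq1_gt0 n1) => F ?; rewrite big_ord1; congr F; apply: val_inj.
Qed.

Lemma big_ord_eq0 {V : nmodType} {n : nat} (n0 : n = 0%N) (F : 'I_n -> V) :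
  \sum_(i < n) F i = 0.
Proof. by case: _ / (esym n0) F => F; rewrite big_ord0. Qed.

Lemma sum_delta_r {K : pzSemiRingType} {n : nat} (F : nat -> K) (j : 'I_n) :
  \sum_(i < n) F i * (i == j :> nat)%:R = F j.
Proof.
rewrite (bigD1 j) //= eqxx mulr1 big1 ?addr0 // => i ij.
by rewrite (_ : (i == j :> nat) = false) ?mulr0 //; apply/negbTE.
Qed.

Lemma span_ind {K : fieldType} {V : vectType K} (X : seq V) (P : V -> Prop) :
  P 0 -> (forall k u v, P u -> P v -> P (k *: u + v)) ->
  (forall v, v \in X -> P v) -> forall v, v \in <<X>>%VS -> P v.
Proof.
move=> P0 PD PX v /(@coord_span _ _ _ (in_tuple X)) ->.
elim/big_ind: _ => // [x y Px Py|i _].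
  by rewrite -[x]scale1r; apply: PD.
by rewrite -[_ *: _]addr0; apply: PD => //; apply: PX; apply: mem_nth.
Qed.

(** * F- and R-symbols at one-dimensional vertices *)

Section Category.
Context {K : numClosedFieldType} {B : anyonData K}.
Hypothesis hB : is_UBFC B.
Let hN := ubfc_fusion hB.
Implicit Types a b c d e f : B.

Lemma Rsym_norm1 {a b c} : Nf a b c = 1%N -> `|Rsym a b c 0 0| = 1.
Proof.
move=> n1; have n2 : Nf b a c = 1%N by rewrite (fusionC hN).
have := ubfc_R_unitary hB (ord_of1 n2) (ord_of1 n2).
rewrite (big_ord_eq1 n1) eqxx /= -normCK => /eqP.
by rewrite sqrp_eq1 ?normr_ge0 // => /eqP.
Qed.

Lemma Rsym_neq0 {a b c} : Nf a b c = 1%N -> Rsym a b c 0 0 != 0.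
Proof. by move=> n1; rewrite -normr_eq0 Rsym_norm1 ?oner_eq0. Qed.

(** Since [e] is the only channel of [a] and [b], the normalisation of the column of F consists of
    the single term [|F|^2 = 1]. *)
Lemma Fsym_neq0 a b c d e f :
  Nf a b e = 1%N -> Nf e c d = 1%N -> Nf b c f = 1%N -> Nf a f d = 1%N ->
  (forall e', e' != e -> Nf a b e' = 0%N) ->
  Fsym a b c d e f 0 0 0 0 != 0.
Proof.
move=> n1 n2 n3 n4 only_e.
have := (ubfc_F_unitary hB).2 _ _ _ _ _ _
  (ord_of1 n3) (ord_of1 n4) (ord_of1 n3) (ord_of1 n4).
rewrite !eqxx (bigD1 e) //= [X in _ + X]big1 ?addr0; last first.
  by move=> e' /only_e n0; rewrite (big_ord_eq0 n0).
rewrite (big_ord_eq1 n1) (big_ord_eq1 n2) /= => FF.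
by apply: contra_eq_neq FF => ->; rewrite mulr0 eq_sym oner_eq0.
Qed.

Lemma hexagon_dim1 a b c d e f g :
  Nf c a e = 1%N -> Nf e b d = 1%N -> Nf b c g = 1%N -> Nf a g d = 1%N ->
  Nf a b f = 1%N -> Nf c f d = 1%N ->
  (forall f', f' != f -> Nf a b f' = 0%N) ->
  Rsym a c e 0 0 * Fsym a c b d e g 0 0 0 0 * Rsym b c g 0 0
  = Fsym c a b d e f 0 0 0 0 * Rsym f c d 0 0 * Fsym a b c d f g 0 0 0 0.
Proof.
move=> n1 n2 n3 n4 n5 n6 only_f.
have n1' : Nf a c e = 1%N by rewrite (fusionC hN).
have n3' : Nf c b g = 1%N by rewrite (fusionC hN).
have n6' : Nf f c d = 1%N by rewrite (fusionC hN).
have := ubfc_hexagon hB (ord_of1 n1) (ord_of1 n2) (ord_of1 n3) (ord_of1 n4).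
rewrite (big_ord_eq1 n1') (big_ord_eq1 n3') /= => ->.
rewrite (bigD1 f) //= [X in _ + X]big1 ?addr0; last first.
  by move=> f' /only_f n0; rewrite (big_ord_eq0 n0).
by rewrite (big_ord_eq1 n5) (big_ord_eq1 n6) (big_ord_eq1 n6').
Qed.

(** The hexagon with two vacuum strands reads [R * R = R], and [R] is nonzero. *)
Lemma Rsym_vac a : Rsym (vac B) a a 0 0 = 1.
Proof.
have n1 : Nf a (vac B) a = 1%N by rewrite (fusion1r hN) eqxx.
have n2 : Nf (vac B) a a = 1%N by rewrite (fusion1l hN) eqxx.
have n3 : Nf (vac B) (vac B) (vac B) = 1%N by rewrite (fusion1l hN) eqxx.
have [F1 F2 _] := ubfc_F_unital hB.
have /= F3 := F1 _ _ _ (ord_of1 n1) (ord_of1 n1).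
have /= F4 := F2 _ _ _ (ord_of1 n1) (ord_of1 n1).
have /= F5 := F1 _ _ _ (ord_of1 n2) (ord_of1 n2).
have := hexagon_dim1 (vac B) (vac B) a a a (vac B) a n1 n1 n2 n2 n3 n1.
rewrite F3 F4 F5 !mulr1 mul1r => H.
apply: (mulfI (Rsym_neq0 n2)); rewrite mulr1; apply: H => f nf.
by rewrite (fusion1l hN) eq_sym (negbTE nf).
Qed.

(** * Fusion with the fermion *)

Section Fermion.
Context {psi : B}.
Hypothesis psi2 : forall c, Nf psi psi c = (c == vac B).

Lemma fusion_psi_twice a d : (\sum_e Nf a psi e * Nf e psi d)%N = (d == a).
Proof.
rewrite (fusionA hN) (bigD1 (vac B)) //= psi2 eqxx mul1n (fusion1r hN) big1.
  by rewrite addn0 eq_sym.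
by move=> f nf; rewrite psi2 (negbTE nf).
Qed.

(** Some [d] occurs in [c x psi]. The path [a, c, d] is counted in [fusion_psi_twice], whose total
    is at most 1 and vanishes unless [d = a]; so both multiplicities are 1. *)
Lemma fusion_psiV a c : Nf a psi c != 0%N -> Nf c psi a = 1%N /\ Nf a psi c = 1%N.
Proof.
move=> nac.
have [d nd] : exists d, Nf c psi d != 0%N.
  case: (boolP [exists d, Nf c psi d != 0%N]) => [/existsP //|/existsPn h].
  have := fusion_psi_twice c c; rewrite eqxx big1 // => e _.
  by move: (h e); rewrite negbK => /eqP ->.
have : (Nf a psi c * Nf c psi d <= (d == a))%N.
  by rewrite -fusion_psi_twice (bigD1 c) //= leq_addr.
case: (eqVneq d a) nd => [-> nd|_ nd]; last first.
  by rewrite leqn0 muln_eq0 (negbTE nac) (negbTE nd).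
move=> h; have : (Nf a psi c * Nf c psi a == 1)%N.
  by rewrite eqn_leq h muln_gt0 !lt0n nac nd.
by rewrite muln_eq1 => /andP[/eqP -> /eqP ->].
Qed.

(** A channel exists, so the default value in [fuse_psi] is never taken; a second channel would
    raise the count in [fusion_psi_twice a a] above 1. *)
Lemma fusion_psiE a c : Nf a psi c = (c == fuse_psi psi a).
Proof.
rewrite /fuse_psi; case: pickP => [c0 h0|/= h]; last first.
  have := fusion_psi_twice a a; rewrite eqxx big1 // => e _.
  by move/negbT: (h e); rewrite negbK => /eqP ->.
have [n1 n2] := fusion_psiV _ _ h0.
rewrite /=; case: eqVneq => [->//|ne].
apply/eqP/negPn/negP => /fusion_psiV [m1 m2].
have := fusion_psi_twice a a.
by rewrite eqxx (bigD1 c0) //= (bigD1 c) //= n1 n2 m1 m2.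
Qed.

Lemma fuse_psiK : involutive (fuse_psi psi).
Proof.
move=> a; have : Nf a psi (fuse_psi psi a) != 0%N by rewrite fusion_psiE eqxx.
move/fusion_psiV => [+ _]; rewrite fusion_psiE.
by case: eqVneq.
Qed.

Lemma fusion_psil a c : Nf psi a c = (c == fuse_psi psi a).
Proof. by rewrite (fusionC hN) fusion_psiE. Qed.

(** Count the vacuum in [psi x a x dual a] in both ways: fusing [psi] with [a] first gives 1, and
    fusing [a] with [dual a] first leaves only the channel [psi], which is self-dual. *)
Lemma fusion_dual_psi a :
  fuse_psi psi a = a -> Nf a (dual a) psi = 1%N.
Proof.
move=> fa; have := fusionA hN psi a (dual a) (vac B).
rewrite (bigD1 a) //= fusion_psil fa eqxx (fusionV hN) eqxx big1; last first.
  by move=> e ne; rewrite fusion_psil fa (negbTE ne).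
rewrite (bigD1 psi) //= psi2 eqxx !muln1 big1 ?addn0; first by move=> <-.
move=> f nf.
have dpsi : dual psi = psi.
  by have := fusionV hN psi psi; rewrite psi2 eqxx; case: eqVneq.
by rewrite (fusionV hN) dpsi (negbTE nf) muln0.
Qed.

(** * The fermionic sign in F and in the vertex action of [alpha_psi] *)

Hypothesis Rpsi : Rsym psi psi (vac B) 0 0 = -1.

(** In the hexagon for the strands [psi, s, psi], the nonzero factor [F^{psi,psi,s}_s R^{s,psi}_s]
    occurs on both sides and cancels. *)
Lemma Fsym_psi_sigma_psi s : fuse_psi psi s = s ->
  Fsym psi s psi s s s 0 0 0 0 = -1.
Proof.
move=> fs.
have n1 : Nf psi psi (vac B) = 1%N by rewrite psi2 eqxx.
have n2 : Nf (vac B) s s = 1%N by rewrite (fusion1l hN) eqxx.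
have n3 : Nf s psi s = 1%N by rewrite fusion_psiE fs eqxx.
have n4 : Nf psi s s = 1%N by rewrite fusion_psil fs eqxx.
have := hexagon_dim1 psi s psi s (vac B) s s n1 n2 n3 n4 n4 n4.
rewrite Rpsi mulN1r mulNr => H.
have F0 : Fsym psi psi s s (vac B) s 0 0 0 0 != 0.
  by apply: Fsym_neq0 => // e ne; rewrite psi2 (negbTE ne).
apply: (mulfI (mulf_neq0 F0 (Rsym_neq0 n3))); rewrite mulrN1 -H // => f nf.
by rewrite fusion_psil fs (negbTE nf).
Qed.

Lemma aut_vtx_norm1 rho a b c : is_topological_aut psi rho ->
  Nf a b c = 1%N -> `|avtx rho a b c 0 0| = 1.
Proof.
move=> hrho n1; have := aut_unitary hrho (ord_of1 n1) (ord_of1 n1).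
rewrite (big_ord_eq1 n1) eqxx /= -normCK => /eqP.
by rewrite sqrp_eq1 ?normr_ge0 // => /eqP.
Qed.

(* Naturality of F^{psi,s,dual s} under rho expresses the left-hand side as
   U(psi,s;s); naturality of the braiding then exchanges psi and s. *)
Lemma aut_torus_factor_psi rho s : is_topological_aut psi rho ->
  aanti rho = false -> rho s = s -> fuse_psi psi s = s ->
  avtx rho s (dual s) (vac B) 0 0 * (avtx rho s (dual s) psi 0 0)^*
  = avtx rho s psi s 0 0.
Proof.
move=> hrho lin rs fs.
have n1 : Nf psi s s = 1%N by rewrite fusion_psil fs eqxx.
have n2 : Nf s (dual s) psi = 1%N by exact: fusion_dual_psi.
have n3 : Nf s (dual s) (vac B) = 1%N by rewrite (fusionV hN) eqxx.
have n4 : Nf psi (vac B) psi = 1%N by rewrite (fusion1r hN) eqxx.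
have n5 : Nf s psi s = 1%N by rewrite fusion_psiE fs eqxx.
have rd : rho (dual s) = dual s.
  have := aut_N hrho s (dual s) (vac B).
  by rewrite rs (aut_vac hrho) n3 (fusionV hN); case: eqVneq.
have [U1 _] := aut_unital hrho psi.
have F0 : Fsym psi s (dual s) psi s (vac B) 0 0 0 0 != 0.
  by apply: Fsym_neq0 => // e ne; rewrite fusion_psil fs (negbTE ne).
have := aut_F hrho (ord_of1 n1) (ord_of1 n2) (ord_of1 n3) (ord_of1 n4).
rewrite (big_ord_eq1 n1) (big_ord_eq1 n2) (big_ord_eq1 n3) (big_ord_eq1 n4) /=.
rewrite lin rs rd (aut_vac hrho) (aut_psi hrho) U1 mulr1 /= mulrC.
move=> /(mulfI F0) <-.
have := aut_R hrho (ord_of1 n5) (ord_of1 n1).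
rewrite (big_ord_eq1 n5) (big_ord_eq1 n1) /= lin rs (aut_psi hrho) /= mulrC.
move=> /(mulfI (Rsym_neq0 n1)) ->.
by rewrite -mulrA -normCK aut_vtx_norm1 // expr1n mulr1.
Qed.

Hypothesis halpha : is_topological_aut psi (alpha_psi psi).

Lemma alpha_psi_vtx_sigma s : in_sigma psi s ->
  avtx (alpha_psi psi) s psi s 0 0 = -1.
Proof.
case/andP => s1 /eqP fs.
(* Otherwise [alpha_psi] would send [psi] to [psi x psi]; as it fixes [psi], this makes [psi] the
   vacuum, whose self-braiding is 1 and not -1. *)
have p0 : in_sector1 psi psi = false.
  apply/negbTE/negP => p1; have := aut_psi halpha; rewrite /= p1 /= => fp.
  have := fusion_psiE psi psi; rewrite fp eqxx psi2.
  case: eqVneq => // pv _.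
  by move: Rpsi; rewrite pv Rsym_vac => /eqP; rewrite eq_sym eqNr oner_eq0.
have n3 : Nf s psi s = 1%N by rewrite fusion_psiE fs eqxx.
(* With exponents 0 for [psi] and 1 for [s], the first F-symbol and the R-symbol have a vacuum leg;
   only the conjugate of [F^{psi,s,psi}_s] remains. *)
rewrite /= p0 s1 /= fs (big_ord_eq1 n3) /=.
have [_ F2 _] := ubfc_F_unital hB.
have := F2 s psi s (ord_of1 n3) (ord_of1 n3).
rewrite eqxx /Finv /= => ->.
by rewrite Fsym_psi_sigma_psi // Rsym_vac rmorph1 !mul1r rmorphN1.
Qed.

(* alpha_psi sends a in sector 0 to a; if a x psi were in sector 1, it would be
   sent to a as well, against injectivity. *)
Lemma in_sector0_fuse_psi a : in_sector0 psi (fuse_psi psi a) = in_sector0 psi a.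
Proof.
suff H b : in_sector0 psi b -> in_sector0 psi (fuse_psi psi b).
  by apply/idP/idP => /H; rewrite ?fuse_psiK.
move=> b0; apply/negPn/negP => b1.
have e : alpha_psi psi (fuse_psi psi b) = alpha_psi psi b.
  by rewrite /= /in_sector1 b1 b0 /= fuse_psiK.
by move: b1; rewrite (aut_inj halpha e) b0.
Qed.

End Fermion.
End Category.

(** * Autoequivalences acting on torus states *)

Section TorusAction.
Context {K : numClosedFieldType} {B : anyonData K} {psi : B}.
Implicit Types (a : B) (p w : bool) (rho sigma X : autoData B).
Implicit Types (Psi Phi : torus_space K B).

(** The phase acquired by [ket a p], apart from the permutation of labels. *)
Definition torus_factor rho a p : K :=
  avtx rho a (dual a) (vac B) 0 0 * (avtx rho a (dual a) (psi_exp psi p) 0 0)^*.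

Lemma torus_act_linear rho k Psi Phi : aanti rho = false ->
  torus_act psi rho (k *: Psi + Phi)
  = k *: torus_act psi rho Psi + torus_act psi rho Phi.
Proof.
move=> lin; rewrite /torus_act lin scaler_sumr -big_split /=.
apply: eq_bigr => a _; rewrite scaler_sumr -big_split /=.
apply: eq_bigr => p _; rewrite !ffunE scalerA -scalerDl mulrDl.
by rewrite [k * (_ * _)]mulrA.
Qed.

Lemma torus_act0 rho : torus_act psi rho 0 = 0.
Proof.
rewrite /torus_act big1 // => a _; rewrite big1 // => p _.
by rewrite ffunE /conj_if; case: aanti; rewrite ?rmorph0 mul0r scale0r.
Qed.

Lemma parity_exp_linear w k Psi Phi :
  parity_exp w (k *: Psi + Phi) = k *: parity_exp w Psi + parity_exp w Phi.
Proof. by apply/ffunP => x; rewrite !ffunE mulrDr [in LHS]mulrCA. Qed.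

Lemma parity_exp0 w : parity_exp w (0 : torus_space K B) = 0.
Proof. by apply/ffunP => x; rewrite !ffunE mulr0. Qed.

Lemma torus_act_ket rho a p :
  torus_act psi rho (ket a p) = torus_factor rho a p *: ket (rho a) p.
Proof.
rewrite /torus_act (bigD1 a) //= [X in _ + X]big1 ?addr0; last first.
  move=> b nb; rewrite big1 // => p' _; rewrite ffunE xpair_eqE (negbTE nb).
  by rewrite /conj_if; case: aanti; rewrite ?rmorph0 mul0r scale0r.
rewrite (bigD1 p) //= [X in _ + X]big1 ?addr0; last first.
  move=> p' np; rewrite ffunE xpair_eqE (negbTE np) andbF.
  by rewrite /conj_if; case: aanti; rewrite ?rmorph0 mul0r scale0r.
by rewrite ffunE eqxx /conj_if; case: aanti; rewrite ?rmorph1 mul1r.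
Qed.

Lemma parity_exp_ket w a p :
  parity_exp w (ket a p : torus_space K B) = (-1) ^+ (w && p) *: ket a p.
Proof.
apply/ffunP => x; rewrite !ffunE; case: eqVneq => [->|_] //=.
by rewrite !mulr0 scaler0.
Qed.

(** The natural isomorphism is composed on the left, so [gamma] is evaluated at the images of the
    labels; equality of multiplicities lets vertex labels be transported there. *)
Lemma LR_eq_vtx rho sigma : LR_eq psi rho sigma ->
  [/\ aanti rho = aanti sigma, forall a, rho a = sigma a
  & exists2 gamma, phases gamma /\ gamma psi = 1
    & forall a b c (mu nu : 'I_(Nf a b c)),
        Nf (sigma a) (sigma b) (sigma c) = Nf a b c ->
        avtx rho a b c mu nu * (gamma (sigma a) * gamma (sigma b) / gamma (sigma c))
        = avtx sigma a b c mu nu].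
Proof.
case=> Ups [[gamma [ph gp [U1 U2 U3]]] [V1 V2 V3]].
have E a : rho a = sigma a by rewrite -V2 /= U2.
split=> //; first by rewrite -V1 /= U1.
exists gamma => // a b c mu nu hn; rewrite -V3 /= U1 /=.
have e : Nf a b c = Nf (rho a) (rho b) (rho c) by rewrite !E hn.
have UE la : avtx Ups (rho a) (rho b) (rho c) (la : 'I_(Nf a b c)) nu
    = gamma (sigma a) * gamma (sigma b) / gamma (sigma c) * (la == nu :> nat)%:R.
  by rewrite -!E -[RHS](U3 _ _ _ (cast_ord e la) (cast_ord e nu)).
under eq_bigr => la _ do rewrite UE mulrA.
by rewrite (sum_delta_r (fun la => avtx rho a b c mu la * _) nu).
Qed.

(** The two vertices share the phases of [a] and [dual a], which cancel against their conjugates;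
    the remaining phases, of the vacuum and of [psi], are 1. *)
Lemma LR_eq_torus_factor rho sigma a p : LR_eq psi rho sigma ->
  (forall b c d, Nf (sigma b) (sigma c) (sigma d) = Nf b c d) ->
  sigma (vac B) = vac B -> sigma psi = psi ->
  Nf a (dual a) (vac B) = 1%N -> Nf a (dual a) (psi_exp psi p) = 1%N ->
  torus_factor rho a p = torus_factor sigma a p.
Proof.
move=> /LR_eq_vtx[_ _ [gamma [[g1 gv] gp] E]] sN sv sp n1 n2.
rewrite /torus_factor -(E _ _ _ (ord_of1 n1) (ord_of1 n1)) //.
rewrite -(E _ _ _ (ord_of1 n2) (ord_of1 n2)) //=.
have -> : gamma (sigma (psi_exp psi p)) = 1 by case: p {n2} => /=; rewrite ?sv ?sp.
rewrite sv gv rmorphM mulrACA -normCK normrM normfV normrM !g1.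
by rewrite normr1 divr1 mulr1 expr1n mulr1.
Qed.

(** The signs at [a] and [dual a] cancel between the two vertices, even if one of them is [psi]; the
    sign at the outgoing leg survives exactly when that leg is [psi]. *)
Lemma torus_factor_comp_Upsilon rho w a p : psi != vac B ->
  Nf a (dual a) (vac B) = 1%N -> Nf a (dual a) (psi_exp psi p) = 1%N ->
  torus_factor (aut_comp rho (aut_expb (Upsilon_psi psi) w)) a p
  = (-1) ^+ (w && p) * torus_factor rho a p.
Proof.
move=> pv n1 n2; rewrite /torus_factor /= (big_ord_eq1 n1) (big_ord_eq1 n2) /=.
case: w => /=; last first.
  by rewrite /conj_if; case: aanti; rewrite ?rmorph1 expr0 !mul1r.
rewrite [vac B == psi]eq_sym (negbTE pv) divr1 !mulr1 [in LHS]rmorphM mulrACA.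
congr (_ * _).
have -> : (psi_exp psi p == psi) = p by case: (p); rewrite /= ?eqxx // eq_sym (negbTE pv).
rewrite /conj_if; case: aanti; case: (a == psi); case: (dual a == psi); case: p {n2} => /=;
  by rewrite ?(mulrNN, mulrN1, mulN1r, mul1r, mulr1, invrN1, invr1, opprK, rmorphN1,
    rmorph1, rmorphN, expr0, expr1).
Qed.

Lemma torus_act_ket_orbit rho n a : aanti rho = false ->
  (forall b, torus_factor rho b false = 1) ->
  torus_act psi rho (ket_orbit psi n a)
  = (sqrtC 2)^-1 *: (ket (rho a) false + (-1) ^+ n *: ket (rho (fuse_psi psi a)) false).
Proof.
(* Adding 0 brings the scaled vector into the shape [k *: u + v] of the linearity lemma. *)
move=> lin f1; rewrite -[ket_orbit _ _ _]addr0 torus_act_linear // torus_act0 addr0.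
rewrite addrC torus_act_linear // !torus_act_ket !f1 !scale1r.
by rewrite [in RHS]addrC.
Qed.

Lemma parity_exp_ket_orbit w n a :
  parity_exp w (ket_orbit psi n a) = ket_orbit psi n a.
Proof.
rewrite -[in LHS](addr0 (ket_orbit psi n a)) parity_exp_linear parity_exp0 addr0.
by rewrite addrC parity_exp_linear !parity_exp_ket andbF expr0 !scale1r addrC.
Qed.

Lemma LR_eq_refl rho : LR_eq psi rho rho.
Proof.
exists (nat_iso (fun=> 1)); split.
  by exists (fun=> 1); split=> //; split=> // a; rewrite normr1.
split=> //= a b c mu nu; rewrite !divr1.
by under eq_bigr => la _ do rewrite !mul1r; rewrite (sum_delta_r (avtx rho a b c mu)).
Qed.

(** * Comparison of the lift defect with [alpha_psi] *)

Hypothesis hB : is_UBFC B.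
Hypothesis psi2 : forall c, Nf psi psi c = (c == vac B).
Hypothesis psi_neq_vac : psi != vac B.

(* A locality-respecting natural isomorphism is trivial on |s,psi;s>. *)
Lemma Upsilon_psi_nonlocal s :
  fuse_psi psi s = s -> ~ respects_locality psi (Upsilon_psi psi).
Proof.
move=> fs [gamma [[g1 _] gp [_ _ E]]].
have n1 : Nf s psi s = 1%N by rewrite (fusion_psiE hB psi2) fs eqxx.
have sp : s != psi.
  by apply: contraNneq psi_neq_vac => sp; rewrite sp psi2 in n1; case: eqVneq n1.
have := E _ _ _ (ord_of1 n1) (ord_of1 n1).
rewrite /= (negbTE sp) !eqxx gp !mulr1 divr1 mul1r divff; last first.
  by rewrite -normr_eq0 g1 oner_eq0.
by move/eqP; rewrite eqNr oner_eq0.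
Qed.

Hypothesis Rpsi : Rsym psi psi (vac B) 0 0 = -1.
Hypothesis halpha : is_topological_aut psi (alpha_psi psi).

Lemma torus_factor_alpha_psi a p n : p ==> in_sigma psi a ->
  torus_factor (aut_expb (alpha_psi psi) n) a p = (-1) ^+ (n && p).
Proof.
move=> sa; case: n; last first.
  by rewrite /torus_factor /= conjC1 mul1r expr0.
rewrite andTb.
case: p sa => [/= sa|_]; rewrite /torus_factor [psi_exp _ _]/=; last first.
  rewrite -normCK (aut_vtx_norm1 _ _ _ _ halpha) ?expr1n //.
  by rewrite (fusionV (ubfc_fusion hB)) eqxx.
have /andP[s1 /eqP fs] := sa.
rewrite (aut_torus_factor_psi hB psi2) //; last by rewrite /= s1.
by rewrite (alpha_psi_vtx_sigma hB).
Qed.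

(** The class of [X] determines its permutation of labels and its phases on the kets that occur in
    [Hspace]; the formula is checked on the spanning family. *)
Lemma torus_act_twisted_alpha_psi X w n mu nu Psi :
  LR_eq psi (if `[< respects_locality psi (Upsilon_psi psi) >] then X
             else aut_comp X (aut_expb (Upsilon_psi psi) w))
            (aut_expb (alpha_psi psi) n) ->
  Psi \in Hspace psi mu nu ->
  torus_act psi X Psi = ((-1) ^+ (n * Arf mu nu)%N : K) *: parity_exp w Psi.
Proof.
move=> XE; set beta := aut_expb (alpha_psi psi) n in XE.
have [lin objE _] := LR_eq_vtx _ _ XE.
have {}lin : aanti X = false.
  by move: lin; rewrite /beta /=; case: ifP => _; case: (w); case: (n); rewrite /= ?addbF.
have {}objE a : X a = beta a by rewrite -objE; case: ifP => _ //=; case: (w).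
have fac a p : p ==> in_sigma psi a -> torus_factor X a p = (-1) ^+ ((w && p) + (n && p)).
  move=> sa.
  have n1 : Nf a (dual a) (vac B) = 1%N by rewrite (fusionV (ubfc_fusion hB)) eqxx.
  have n2 : Nf a (dual a) (psi_exp psi p) = 1%N.
    by case: p sa => //= /andP[_ /eqP]; apply: fusion_dual_psi.
  rewrite exprD -(torus_factor_alpha_psi a p n sa) -(LR_eq_torus_factor _ _ a p XE) //.
  (* If [Upsilon_psi] is not local, its sign enters twice and squares to 1. If it is local, there is
     no [psi]-absorbing object, so [p] is false. *)
  - case: asboolP => [loc|_]; last first.
      by rewrite torus_factor_comp_Upsilon // mulrA -signr_addb addbb mul1r.
    case: p sa {n2} => [/= /andP[_ /eqP fs]|_]; last by rewrite andbF mul1r.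
    by case: (Upsilon_psi_nonlocal _ fs loc).
  - by rewrite /beta; case: (n) => //; apply: (aut_N halpha).
  - by rewrite /beta; case: (n) => //; apply: (aut_vac halpha).
  - by rewrite /beta; case: (n) => //; apply: (aut_psi halpha).
have fac0 a : torus_factor X a false = 1 by rewrite fac // !andbF.
apply: (span_ind (torus_basis psi mu nu)
  (fun Psi => torus_act psi X Psi = ((-1) ^+ (n * Arf mu nu)%N : K) *: parity_exp w Psi)).
- by rewrite torus_act0 parity_exp0 scaler0.
- move=> k u v Eu Ev; rewrite torus_act_linear // parity_exp_linear Eu Ev.
  by rewrite scalerDr !scalerA mulrC.
move=> v; rewrite /torus_basis; case: mu => /=; last first.
  (* In sector 0 both members of the orbit are fixed, and the Arf invariant vanishes. *)
  case/imageP => a a0 ->.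
  rewrite torus_act_ket_orbit // parity_exp_ket_orbit muln0 scale1r !objE.
  rewrite /beta; case: (n) => //=.
  by rewrite /in_sector1 (in_sector0_fuse_psi hB) // (a0 : in_sector0 psi a).
rewrite mem_cat => /orP[] /imageP[a].
  case/andP => a1 _ ->.
  rewrite torus_act_ket_orbit // parity_exp_ket_orbit !objE /beta /Arf mul1n.
  case: (n) => /=; last by rewrite scale1r.
  (* [alpha_psi] exchanges [v] and [v x psi], which multiplies the orbit state by [(-1)^nu]. *)
  rewrite {1 2}/in_sector1 (in_sector0_fuse_psi hB) // (a1 : ~~ in_sector0 psi a) /=.
  rewrite (fuse_psiK hB) // mul1n /ket_orbit [in RHS]scalerA mulrC -[in RHS]scalerA.
  by rewrite [in RHS]scalerDr scalerA -signr_addb addbb scale1r addrC.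
(* Here the puncture flag is [nu] itself: [w && nu] is the parity exponent and [n && nu] the Arf
   exponent. *)
move=> sa ->; have sa' : in_sigma psi a by [].
have [a1 /eqP fa] := andP sa'.
rewrite torus_act_ket fac ?sa' ?implybT // parity_exp_ket scalerA objE.
have -> : beta a = a by rewrite /beta; case: (n) => //=; rewrite a1 /= fa.
by rewrite /Arf mul1n mulnb addnC exprD.
Qed.

End TorusAction.

(** * Self-braiding of the fermion, and passage to the modular extension *)

Lemma twist_fermion {K : numClosedFieldType} {B : anyonData K} {psi : B} :
  is_UBFC B -> (forall c, Nf psi psi c = (c == vac B)) ->
  twist psi = -1 -> Rsym psi psi (vac B) 0 0 = -1.
Proof.
move=> hB psi2; have hN := ubfc_fusion hB.
have n1 : Nf psi psi (vac B) = 1%N by rewrite psi2 eqxx.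
have n2 : Nf (vac B) (vac B) (vac B) = 1%N by rewrite (fusion1r hN) eqxx.
have q1 : qdim (vac B) = 1.
  have dv : dual (vac B) = vac B.
    by have := fusionV hN (vac B) (vac B); rewrite n2; case: eqVneq.
  have [F1 _ _] := ubfc_F_unital hB.
  have := F1 _ _ _ (ord_of1 n2) (ord_of1 n2).
  by rewrite /qdim dv eqxx /= => ->; rewrite normr1 invr1.
rewrite /twist (bigD1 (vac B)) //= [X in _ + X]big1 ?addr0; last first.
  move=> c nc; have n0 : Nf psi psi c = 0%N by rewrite psi2 (negbTE nc).
  by rewrite (big_ord_eq0 n0).
rewrite (big_ord_eq1 n1) /= q1 div1r => tw.
(* Both the twist and [R] have norm 1, and [qdim psi] is nonnegative, so [qdim psi] is 1 and the
   twist equals [R]. *)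
have : `|(qdim psi)^-1| = 1.
  by have := congr1 Num.norm tw; rewrite normrM Rsym_norm1 // mulr1 normrN1.
by rewrite ger0_norm ?invr_ge0 ?invr_ge0 // => q; rewrite q mul1r in tw.
Qed.

Theorem mainTheorem10 (R : realType)
  (C : anyonData R[i]) (psi : C) (hC : is_supermodular psi)
  (Cx : anyonData R[i]) (iota : C -> Cx)
  (hCx : minimal_modular_extension iota)
  (G : groupType) (q : G -> bool)
  (omega2 : G -> G -> bool) (homega2 : is_cocycle2 omega2)
  (rho : G -> autoData C) (hrho : fermionic_action psi q omega2 rho)
  (rhox : G -> autoData Cx)
  (hrhox : forall g, is_LR_aut (iota psi) (rhox g)
                     /\ r_maps_to iota psi (rhox g) (rho g))
  (hker : forall X : autoData Cx,
     in_ker_r iota psi X <->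
     LR_eq (iota psi) X aut_id \/ LR_eq (iota psi) X (alpha_psi (iota psi)))
  (hZ2 : ~ LR_eq (iota psi) (alpha_psi (iota psi)) aut_id)
  (o2 : G -> G -> bool)
  (ho2 : forall g h,
     LR_eq (iota psi) (obstruction2 (iota psi) rhox omega2 g h)
           (aut_expb (alpha_psi (iota psi)) (o2 g h)))
  (mu nu : bool) (Psi : torus_space R[i] Cx)
  (hPsi : Psi \in Hspace (iota psi) mu nu) (g h : G) :
  torus_act (iota psi) (lift_defect rhox g h) Psi
  = ((-1) ^+ (o2 g h * Arf mu nu)%N : R[i])
      *: parity_exp (omega2 g h) Psi.
Proof.
have [hB pv _ psi2 tw] := hC.
have [[hBx _] [iinj ivac iN iclosed] _ hR _] := hCx.
(* The image of [iota] is closed under fusion, so no channel lies outside it. *)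
have psi2x c : Nf (iota psi) (iota psi) c = (c == vac Cx).
  have [|/iclosed[d ->]] := eqVneq (Nf (iota psi) (iota psi) c) 0%N.
    case: eqVneq => // ->; by rewrite -ivac iN psi2 eqxx.
  by rewrite iN psi2 -ivac (inj_eq iinj).
have pvx : iota psi != vac Cx by rewrite -ivac (inj_eq iinj).
have n1 : Nf psi psi (vac C) = 1%N by rewrite psi2 eqxx.
have Rx : Rsym (iota psi) (iota psi) (vac Cx) 0 0 = -1.
  by rewrite -ivac (hR _ _ _ (ord_of1 n1) (ord_of1 n1)) (twist_fermion hB psi2 tw).
(* Membership of [alpha_psi] in the kernel of restriction includes its being a topological
   autoequivalence. *)
have [[halpha _] _] := (hker _).2 (or_intror (LR_eq_refl (alpha_psi (iota psi)))).
exact: (torus_act_twisted_alpha_psi hBx psi2x pvx Rx halpha _ _ _ _ _ _ (ho2 g h)).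
Qed.
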